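(* Let $A,B\in\mathbb{R}^{n\times n}$ be both symmetric (or both skew-symmetric), and let $P\in\mathbb{R}^{n^2\times n^2}$ be a symmetric, involutory matrix. Then $A\otimes B+P(A\otimes B)P$ has an eigendecomposition such that the eigenvectors decompose into symmetric and skew-symmetric vectors. Furthermore, the eigenvalues corresponding to the symmetric eigenvectors are the eigenvalues of $2\Theta^\top(A\otimes B)\Theta$, and the ones corresponding to the skew-symmetric eigenvectors are the eigenvalues of $2\tilde\Theta^\top(A\otimes B)\tilde\Theta$, where $\Theta\in\mathbb{R}^{n^2\times s}$ and $\tilde\Theta\in\mathbb{R}^{n^2\times t}$ are such that $P\Theta=\Theta$ and $P\tilde\Theta=-\tilde\Theta$.
   Context: $\otimes$ is the Kronecker product. A matrix $P$ is involutory if $P^2=I$, the identity matrix. Relative to the given $P$, a vector $x\in\mathbb{R}^{n^2}$ is called symmetric if $Px=x$ and skew-symmetric if $Px=-x$. The integers $s$ and $t$ are the dimensions of $\{x\in\mathbb{R}^{n^2}:Px=x\}$ and $\{x\in\mathbb{R}^{n^2}:Px=-x\}$, respectively.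
   Formalization: The columns of Θ and Θ̃ are additionally required to be orthonormal (ΘᵀΘ = I, Θ̃ᵀΘ̃ = I), and such matrices are shown to exist; without this the claim fails, e.g. n = 1, A = B = P = 1, Θ = 0. *)

(* Defs.v *)
From mathcomp Require Import all_boot all_order all_algebra.
From mathcomp Require Import reals.
From mathcomp.real_closed Require Export mxtens.

Set Implicit Arguments.
Unset Strict Implicit.
Unset Printing Implicit Defensive.

Import GRing.Theory.
Local Open Scope ring_scope.

Definition symmetric_vec (F : fieldType) (m : nat) (P : 'M[F]_m) (x : 'cV[F]_m)
  : bool := P *m x == x.

Definition skew_vec (F : fieldType) (m : nat) (P : 'M[F]_m) (x : 'cV[F]_m)
  : bool := P *m x == - x.

(* [eigenspace] consists of row vectors u with u *m g = a *: u; the transpose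
   of P turns this into the equation P *m x = a *: x on columns x = u^T, as
   [symmetric_vecE] and [skew_vecE] below check. *)
Definition sym_dim (F : fieldType) (m : nat) (P : 'M[F]_m) : nat :=
  \rank (eigenspace P^T 1).

Definition skew_dim (F : fieldType) (m : nat) (P : 'M[F]_m) : nat :=
  \rank (eigenspace P^T (-1)).

Lemma symmetric_vecE (F : fieldType) (m : nat) (P : 'M[F]_m) (x : 'cV[F]_m) :
  (x^T <= eigenspace P^T 1)%MS = symmetric_vec P x.
Proof.
rewrite /symmetric_vec; apply/eigenspaceP/eqP; rewrite -trmx_mul scale1r.
  exact: trmx_inj.
by move->.
Qed.

Lemma skew_vecE (F : fieldType) (m : nat) (P : 'M[F]_m) (x : 'cV[F]_m) :
  (x^T <= eigenspace P^T (-1))%MS = skew_vec P x.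
Proof.
rewrite /skew_vec; apply/eigenspaceP/eqP; rewrite -trmx_mul scaleN1r -linearN.
  exact: trmx_inj.
by move->.
Qed.

Definition eigendecomposition (F : fieldType) (m : nat) (M X : 'M[F]_m)
    (d : 'rV[F]_m) : Prop :=
  X \in unitmx /\ M = X *m diag_mx d *m invmx X.

Definition splits_sym_skew (F : fieldType) (m : nat) (P X : 'M[F]_m) : Prop :=
  forall j : 'I_m, symmetric_vec P (col j X) || skew_vec P (col j X).

Definition sym_eigenvalues (F : fieldType) (m : nat) (P X : 'M[F]_m)
    (d : 'rV[F]_m) : seq F :=
  [seq d 0 j | j <- enum 'I_m & symmetric_vec P (col j X)].

Definition skew_eigenvalues (F : fieldType) (m : nat) (P X : 'M[F]_m)
    (d : 'rV[F]_m) : seq F :=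
  [seq d 0 j | j <- enum 'I_m & skew_vec P (col j X)].

(* The eigenvalues of N, all of which lie in F, are the entries of l, repeated
   according to algebraic multiplicity. *)
Definition eigenvalues_are (F : fieldType) (k : nat) (N : 'M[F]_k) (l : seq F)
  : Prop := char_poly N = \prod_(a <- l) ('X - a%:P).

(* Theta is an orthonormal basis of {x | P x = x}. P Theta = Theta alone
   would allow rescaling Theta (or Theta = 0), which changes the eigenvalues of
   Theta^T K Theta for a fixed matrix K. *)
Definition sym_basis (F : fieldType) (m : nat) (P : 'M[F]_m)
    (Theta : 'M[F]_(m, sym_dim P)) : Prop :=
  Theta^T *m Theta = 1%:M /\ P *m Theta = Theta.

Definition skew_basis (F : fieldType) (m : nat) (P : 'M[F]_m)
    (Theta : 'M[F]_(m, skew_dim P)) : Prop :=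
  Theta^T *m Theta = 1%:M /\ P *m Theta = - Theta.

(* Main.v *)
(* M := A (x) B + P (A (x) B) P is symmetric and commutes with P, so it preserves
   the eigenspaces of P for 1 and -1, whose direct sum is the whole space.  The
   spectral theorem on each of them gives orthonormal eigenbases, which are
   mutually orthogonal and together diagonalize M.  Since P Theta = a Theta with
   a^2 = 1, 2 Theta^T (A (x) B) Theta = Theta^T M Theta.  If X diagonalizes M and
   Y consists of the columns of X lying in the a-eigenspace of P, then there are
   as many of them as the dimension of that space, Y = Theta C with
   C = Theta^T Y invertible, and C conjugates Theta^T M Theta to the diagonal
   matrix of the corresponding eigenvalues. *)
Require Import Defs.
From mathcomp Require Import all_boot all_order all_algebra.
From mathcomp Require Import reals.
From mathcomp Require Import zify.
From mathcomp.real_closed Require complex.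

Set Implicit Arguments.
Unset Strict Implicit.
Unset Printing Implicit Defensive.

Import GRing.Theory.
Local Open Scope ring_scope.

(** * Orthonormal eigenvectors of a symmetric matrix inside a stable subspace *)

Section SymmetricEigenvectors.
Import Order.TTheory Num.Theory complex.
Variable R : rcfType.

Lemma row_norm_eq0 n (w : 'rV[R]_n) : (w *m w^T == 0) = (w == 0).
Proof.
apply/eqP/eqP => [|->]; last by rewrite mul0mx.
move/matrixP/(_ 0 0); rewrite !mxE => w0; apply/rowP => j; rewrite mxE.
have /psumr_eq0P/(_ w0 j isT)/eqP : forall i, true -> 0 <= w 0 i * w^T i 0.
  by move=> i _; rewrite mxE -expr2 sqr_ge0.
by rewrite mxE mulf_eq0 orbb => /eqP.
Qed.

Lemma row_normalize n (w : 'rV[R]_n) :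
  w != 0 -> exists c, (c *: w) *m (c *: w)^T = 1%:M.
Proof.
move=> w0; pose q := (w *m w^T) 0 0.
have wq : w *m w^T = q%:M by rewrite [LHS]mx11_scalar.
have q0 : 0 < q.
  rewrite lt0r; apply/andP; split; last first.
    by rewrite /q mxE sumr_ge0 // => i _; rewrite mxE -expr2 sqr_ge0.
  apply: contra_neq w0 => q0; apply/eqP; rewrite -row_norm_eq0 wq q0.
  by rewrite raddf0.
exists (Num.sqrt q)^-1.
rewrite linearZ /= -scalemxAl -scalemxAr wq scalerA -invfM -expr2.
by rewrite sqr_sqrtr ?ltW // -scalemx1 scalerA mulVf ?scale1r ?gt_eqF.
Qed.

(* l (u u^* ) = u N u^* = l^* (u u^* ), where u u^* <> 0. *)
Lemma symmetric_complex_eigenvalue_real n (N : 'M[R]_n) (l : R[i])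
    (u : 'rV[R[i]]_n) :
  N^T = N -> u != 0 -> u *m map_mx (real_complex R) N = l *: u ->
  l = (complex.Re l)%:C%C.
Proof.
move=> Nsym u0 uN; pose us := (map_mx Num.conj u)^T.
have usN : map_mx (real_complex R) N *m us = Num.conj l *: us.
  rewrite /us -linearZ /= -[LHS]trmxK trmx_mul trmxK map_trmx Nsym.
  congr (_^T); rewrite -(map_mxZ Num.conj) -uN map_mxM /=; congr (_ *m _).
  by apply/matrixP => i j; rewrite !mxE; apply/esym/conjc_real.
have uu0 : (u *m us) 0 0 != 0.
  apply: contra_neq u0; rewrite mxE => uu0; apply/rowP => j; rewrite mxE.
  have /psumr_eq0P/(_ uu0 j isT)/eqP : forall i, true -> 0 <= u 0 i * us i 0.
    by move=> i _; rewrite !mxE mul_conjC_ge0.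
  by rewrite !mxE mul_conjC_eq0 => /eqP.
have : l *: (u *m us) = Num.conj l *: (u *m us).
  by rewrite scalemxAl -uN -mulmxA usN -scalemxAr.
move/matrixP/(_ 0 0); rewrite !mxE => /(mulIf _) lreal.
apply/esym/RRe_real/CrealP/esym/lreal.
by move: uu0; rewrite !mxE.
Qed.

(** In the row basis [B] of [W], [N] acts by a matrix [D] of positive size, which has an eigenvalue
    over [R[i]]. [D] need not be symmetric, but an eigenvector [v] of it lifts to the eigenvector
    [v B] of [N]; hence the eigenvalue is real and already has an eigenvector over [R]. *)
Lemma symmetric_stable_eigenvector m n (N : 'M[R]_n) (W : 'M[R]_(m, n)) :
  N^T = N -> stablemx W N -> W != 0 ->
  exists (a : R) (w : 'rV[R]_n), [/\ w != 0, (w <= W)%MS & w *m N = a *: w].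
Proof.
move=> Nsym WN W0; set B := row_base W.
have /submxP[D BN] : (B *m N <= B)%MS.
  by rewrite (eqmxMr _ (eq_row_base W)) eq_row_base.
have [l] : exists l, eigenvalue (map_mx (real_complex R) D) l.
  by apply: spectral.eigenvalue_closed; rewrite lt0n mxrank_eq0.
move=> lD; have /eigenvalueP[v vD v0] := lD.
have lreal : l = (complex.Re l)%:C%C.
  apply: (@symmetric_complex_eigenvalue_real _ N l
            (v *m map_mx (real_complex R) B)) => //.
    by rewrite mulmx_free_eq0 // row_free_map row_base_free.
  by rewrite -mulmxA -map_mxM BN map_mxM mulmxA vD scalemxAl.
move: lD; rewrite lreal eigenvalue_map => /eigenvalueP[w wD w0].
exists (complex.Re l), (w *m B); split.
- by rewrite mulmx_free_eq0 ?row_base_free.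
- by rewrite mulmx_sub // eq_row_base.
- by rewrite -mulmxA BN mulmxA wD scalemxAl.
Qed.

(* By induction on k: the part of V orthogonal to the k eigenvectors already
   found is stable under N and nonzero, hence contains a further one. *)
Lemma symmetric_stable_spectral m n k (N : 'M[R]_n) (V : 'M[R]_(m, n)) :
  N^T = N -> stablemx V N -> (k <= \rank V)%N ->
  exists (U : 'M[R]_(k, n)) (d : 'rV[R]_k),
    [/\ U *m U^T = 1%:M, (U <= V)%MS & U *m N = diag_mx d *m U].
Proof.
move=> Nsym VN; elim: k => [|k IHk] ltkV.
  by exists 0, 0; split; rewrite ?sub0mx //; apply/matrixP; case.
have [U [d [UU UV UN]]] := IHk (ltnW ltkV).
pose W := (V :&: kermx U^T)%MS.
have WN : stablemx W N.
  rewrite sub_capmx (submx_trans _ VN) ?submxMr ?capmxSl //=.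
  (* For [w] in [W]: w N U^T = w (U N)^T = w U^T diag(d) = 0. *)
  apply/sub_kermxP; rewrite -mulmxA -[N]Nsym -trmx_mul UN trmx_mul mulmxA.
  by rewrite (sub_kermxP (capmxSr _ _)) mul0mx.
have W0 : W != 0.
  (* Dimension count: \rank W is at least (k + 1) + (n - k) - n = 1. *)
  rewrite -mxrank_eq0 -lt0n -(ltn_add2l (\rank (V + kermx U^T))) addn0.
  rewrite mxrank_sum_cap mxrank_ker mxrank_tr.
  have := rank_leq_row U; have := rank_leq_col U.
  have := rank_leq_col (V + kermx U^T)%MS.
  by move: ltkV; lia.
have [a [w0 [w0N0 w0W w0N]]] := symmetric_stable_eigenvector Nsym WN W0.
have [c ww] := row_normalize w0N0; set w := c *: w0 in ww.
have wW : (w <= W)%MS by rewrite scalemx_sub.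
have wU : w *m U^T = 0 by apply/sub_kermxP/(submx_trans wW)/capmxSr.
have Uw : U *m w^T = 0 by rewrite -[U]trmxK -trmx_mul wU trmx0.
rewrite -[k.+1]/(1 + k)%N; exists (col_mx w U), (row_mx a%:M d); split.
- by rewrite tr_col_mx mul_col_row ww UU wU Uw -scalar_mx_block.
- by rewrite -addsmxE addsmx_sub UV (submx_trans wW) ?capmxSl.
- rewrite diag_mx_row mul_block_col mul_col_mx !mul0mx addr0 add0r UN.
  congr col_mx; rewrite -scalemxAl w0N; apply/rowP => j.
  by rewrite mul_diag_mx !mxE mulr1n mulrCA.
Qed.

End SymmetricEigenvectors.

(** * Characteristic polynomials through diagonalization *)

Section SimilarDiagonal.
Variable F : fieldType.

(** [C] intertwines the two characteristic matrices; take determinants and cancel that of [C]. The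
    sizes are linked by an equation because [k] will be a cardinality and [s] a rank. *)
Lemma char_poly_diag_sim s k (N : 'M[F]_s) (C : 'M[F]_(s, k)) (d : 'rV[F]_k) :
  k = s -> row_free C^T -> N *m C = C *m diag_mx d ->
  char_poly N = \prod_(i < k) ('X - (d 0 i)%:P).
Proof.
move=> eks; case: _ / eks N C => N C; rewrite row_free_unit unitmx_tr => Cu NC.
have CXC : char_poly_mx N *m map_mx polyC C =
    map_mx polyC C *m char_poly_mx (diag_mx d).
  by rewrite mulmxBl mulmxBr -!map_mxM NC scalar_mxC.
have C0 : \det (map_mx polyC C) != 0.
  by rewrite det_map_mx polyC_eq0 -unitfE -unitmxE.
have -> : char_poly N = char_poly (diag_mx d).
  by apply: (mulIf C0); rewrite -det_mulmx CXC det_mulmx mulrC.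
rewrite char_poly_trig ?diag_mx_is_trig //.
by apply: eq_bigr => i _; rewrite !mxE eqxx.
Qed.

Lemma row_free_tr_colsub m k (X : 'M[F]_m) (f : 'I_k -> 'I_m) :
  X \in unitmx -> injective f -> row_free (colsub f X)^T.
Proof.
move=> Xu finj; apply/row_freeP; exists (rowsub f (invmx X))^T.
rewrite -trmx_mul -mxsub_mul mulVmx //; apply/matrixP => i j.
by rewrite !mxE (inj_eq finj) eq_sym.
Qed.

Lemma colsub_mul_diag m k (X : 'M[F]_m) (d : 'rV[F]_m) (f : 'I_k -> 'I_m) :
  colsub f (X *m diag_mx d) = colsub f X *m diag_mx (colsub f d).
Proof. by apply/matrixP => i j; rewrite !mul_mx_diag !mxE. Qed.

End SimilarDiagonal.

(** * Eigenspaces of an involution and restriction to them *)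

Section InvolutionEigenspaces.
Variable F : fieldType.

(** The columns of [T] are independent and as many as the dimension of the eigenspace, so they span
    it; thus T T^T fixes every vector of the eigenspace. *)
Lemma eigenspace_basis_project m k (P : 'M[F]_m) (a : F)
    (T : 'M[F]_(m, \rank (eigenspace P^T a))) (Y : 'M[F]_(m, k)) :
  T^T *m T = 1%:M -> P *m T = a *: T -> P *m Y = a *: Y ->
  T *m (T^T *m Y) = Y.
Proof.
move=> TT PT PY.
have TE : (T^T <= eigenspace P^T a)%MS.
  by apply/eigenspaceP; rewrite -trmx_mul PT linearZ.
have YE : (Y^T <= eigenspace P^T a)%MS.
  by apply/eigenspaceP; rewrite -trmx_mul PY linearZ.
have rT : \rank T^T = \rank (eigenspace P^T a).
  by apply/eqP; rewrite -/(row_free _); apply/row_freeP; exists T.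
have eqT : (T^T == eigenspace P^T a)%MS.
  by rewrite -(geq_leqif (mxrank_leqif_eq TE)) rT.
rewrite -(eqmxP eqT) in YE; case/submxP: YE => C YC.
by rewrite -[Y]trmxK YC trmx_mul trmxK !mulmxA -(mulmxA T) TT mulmx1.
Qed.

Lemma eigenspaces_involution_disjoint m (P : 'M[F]_m) : 2%:R != 0 :> F ->
  (eigenspace P 1 :&: eigenspace P (-1) = 0)%MS.
Proof.
move=> nz2; apply/eqP/rowV0P => v; rewrite sub_capmx.
case/andP=> /eigenspaceP vP /eigenspaceP; rewrite vP scaleN1r scale1r.
move/eqP; rewrite -subr_eq0 opprK -mulr2n -scaler_nat scaler_eq0 (negPf nz2).
by move/eqP.
Qed.

Lemma eigenspaces_involution_full m (P : 'M[F]_m) : 2%:R != 0 :> F ->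
  P *m P = 1%:M -> (eigenspace P 1 + eigenspace P (-1) :=: 1%:M)%MS.
Proof.
move=> nz2 PP; apply/eqmxP; rewrite submx1 /=.
(* The two summands are the projections onto the eigenspaces for 1 and -1. *)
have -> : 1%:M = 2%:R^-1 *: (1%:M + P) + 2%:R^-1 *: (1%:M - P).
  rewrite -scalerDr addrACA subrr addr0 -mulr2n -scaler_nat scalerA.
  by rewrite mulVf ?scale1r.
apply: addmx_sub_adds; apply: scalemx_sub; apply/eigenspaceP.
  by rewrite mulmxDl mul1mx PP scale1r addrC.
by rewrite mulmxBl mul1mx PP scaleN1r opprB.
Qed.

Lemma sym_skew_dim m (P : 'M[F]_m) : 2%:R != 0 :> F -> P *m P = 1%:M ->
  (sym_dim P + skew_dim P)%N = m.
Proof.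
move=> nz2 PP; rewrite /sym_dim /skew_dim.
rewrite -(mxrank_disjoint_sum (eigenspaces_involution_disjoint _ nz2)).
by rewrite eigenspaces_involution_full ?mxrank1 // -trmx_mul PP trmx1.
Qed.

Lemma sym_skew_orthogonal m k l (P : 'M[F]_m) (T : 'M[F]_(m, k))
    (T' : 'M[F]_(m, l)) : 2%:R != 0 :> F ->
  P^T = P -> P *m T = T -> P *m T' = - T' -> T^T *m T' = 0.
Proof.
move=> nz2 Psym PT PT'; have : T^T *m T' = - (T^T *m T').
  by rewrite -{1}PT trmx_mul Psym -mulmxA PT' mulmxN.
move/eqP; rewrite -subr_eq0 opprK -mulr2n -scaler_nat scaler_eq0 (negPf nz2).
by move/eqP.
Qed.

Lemma tr_basis_conj_eq m k (P K : 'M[F]_m) (a : F) (T : 'M[F]_(m, k)) :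
  P^T = P -> a * a = 1 -> P *m T = a *: T ->
  T^T *m (K + P *m K *m P) *m T = 2%:R *: (T^T *m K *m T).
Proof.
move=> Psym aa PT; rewrite mulmxDr mulmxDl !mulmxA.
rewrite -{1}Psym -trmx_mul PT -(mulmxA _ P) PT -scalemxAr [(a *: T)^T]linearZ /=.
by rewrite -!scalemxAl scalerA aa scale1r scaler_nat mulr2n.
Qed.

(** The columns of [X] indexed by [S] are independent in the eigenspace, which bounds their number.
    If the bound is attained, their coordinates in the basis [T] form an invertible matrix
    diagonalizing the restriction of [M]. The bound is a separate conclusion so that equality can
    later be forced by counting over both eigenspaces. *)
Lemma char_poly_restricted m (P M X : 'M[F]_m) (d : 'rV[F]_m) (a : F)
    (T : 'M[F]_(m, \rank (eigenspace P^T a))) (S : {pred 'I_m}) :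
  T^T *m T = 1%:M -> P *m T = a *: T ->
  X \in unitmx -> M *m X = X *m diag_mx d ->
  (forall j, j \in S -> P *m col j X = a *: col j X) ->
  (#|S| <= \rank (eigenspace P^T a))%N /\
  (#|S| = \rank (eigenspace P^T a) ->
   char_poly (T^T *m M *m T) = \prod_(j in S) ('X - (d 0 j)%:P)).
Proof.
move=> TT PT Xu MX XS.
pose f : 'I_#|S| -> 'I_m := enum_val; pose Y := colsub f X.
have PY : P *m Y = a *: Y.
  apply/matrixP => i j; have /matrixP/(_ i 0) := XS _ (enum_valP j).
  by rewrite !mxE => <-; apply: eq_bigr => l _; rewrite !mxE.
have TTY := eigenspace_basis_project TT PT PY.
(* Since T (T^T Y) = Y, a left inverse of [Y] yields one of T^T Y. *)
have Yfree : row_free (T^T *m Y)^T.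
  have /row_freeP[Z YZ] : row_free Y^T.
    by apply: row_free_tr_colsub => //; apply: enum_val_inj.
  by apply/row_freeP; exists (T^T *m Z); rewrite mulmxA -trmx_mul TTY.
split; first by rewrite -(eqP Yfree) rank_leq_col.
move=> cardS; rewrite big_enum_val.
rewrite (char_poly_diag_sim (d := colsub f d) cardS Yfree).
  by apply: eq_bigr => i _; rewrite mxE.
by rewrite -!mulmxA TTY mulmx_colsub MX colsub_mul_diag.
Qed.

End InvolutionEigenspaces.

(** * Symmetric matrices commuting with a symmetric involution *)

Section Decomposition.
Variables (R : rcfType) (m : nat) (P M : 'M[R]_m).
Hypotheses (Psym : P^T = P) (PP : P *m P = 1%:M).
Hypotheses (Msym : M^T = M) (PM : P *m M = M *m P).

Let nz2 : 2%:R != 0 :> R. Proof. by rewrite Num.Theory.pnatr_eq0. Qed.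

Lemma eigenspace_spectral_basis (a : R) :
  exists (T : 'M[R]_(m, \rank (eigenspace P^T a)))
         (d : 'rV[R]_(\rank (eigenspace P^T a))),
    [/\ T^T *m T = 1%:M, P *m T = a *: T & M *m T = T *m diag_mx d].
Proof.
have EM : stablemx (eigenspace P^T a) M.
  by apply: comm_mx_stable_eigenspace; rewrite Psym; apply/PM.
have [U [d [UU UE UM]]] := symmetric_stable_spectral Msym EM (leqnn _).
exists U^T, d; split; first by rewrite trmxK.
  by apply: trmx_inj; rewrite trmx_mul trmxK (eigenspaceP UE) linearZ /= trmxK.
by rewrite -Msym -trmx_mul UM trmx_mul tr_diag_mx.
Qed.

(** Transport along [k = m]: gluing the two eigenbases gives [sym_dim P + skew_dim P] columns, a
    number equal to [m] only by a proved equation. *)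
Lemma eigendecomposition_orthogonal k (X : 'M[R]_(m, k)) (d : 'rV[R]_k) :
  k = m -> X^T *m X = 1%:M -> M *m X = X *m diag_mx d ->
  (forall j, symmetric_vec P (col j X) || skew_vec P (col j X)) ->
  exists (X : 'M[R]_m) (d : 'rV[R]_m),
    [/\ eigendecomposition M X d, X^T *m X = 1%:M & splits_sym_skew P X].
Proof.
move=> ekm; move: P M; case: m / ekm X d => X d Q N XX NX spl.
have Xu : X \in unitmx by have [] := mulmx1_unit XX.
by exists X, d; split=> //; split; rewrite // -NX mulmxK.
Qed.

Lemma split_eigendecomposition_exists :
  exists (X : 'M[R]_m) (d : 'rV[R]_m),
    [/\ eigendecomposition M X d, X^T *m X = 1%:M & splits_sym_skew P X].
Proof.
have [T [d [TT PT MT]]] := eigenspace_spectral_basis 1.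
have [T' [d' [TT' PT' MT']]] := eigenspace_spectral_basis (-1).
have TT0 : T^T *m T' = 0.
  by apply: (sym_skew_orthogonal nz2 Psym); rewrite (PT, PT') (scale1r, scaleN1r).
apply: (@eigendecomposition_orthogonal _ (row_mx T T') (row_mx d d')).
- exact: sym_skew_dim.
- rewrite tr_row_mx mul_col_row TT TT' TT0 -[T'^T *m T]trmxK trmx_mul trmxK TT0.
  by rewrite trmx0 -scalar_mx_block.
- rewrite mul_mx_row MT MT' diag_mx_row mul_row_block.
  by rewrite !mulmx0 addr0 add0r.
move=> j; rewrite /symmetric_vec /skew_vec.
case: (split_ordP j) => i ->; rewrite ?colKl ?colKr; apply/orP.
  by left; rewrite colE mulmxA PT scale1r.
by right; rewrite colE mulmxA PT' scaleN1r mulNmx.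
Qed.

Lemma restricted_eigenvalues (X : 'M[R]_m) (d : 'rV[R]_m)
    (T : 'M[R]_(m, sym_dim P)) (T' : 'M[R]_(m, skew_dim P)) :
  eigendecomposition M X d -> splits_sym_skew P X ->
  sym_basis T -> skew_basis T' ->
  eigenvalues_are (T^T *m M *m T) (sym_eigenvalues P X d) /\
  eigenvalues_are (T'^T *m M *m T') (skew_eigenvalues P X d).
Proof.
case=> Xu MX spl [TT PT] [TT' PT'].
have {}MX : M *m X = X *m diag_mx d by rewrite MX mulmxKV.
pose S := [pred j | symmetric_vec P (col j X)].
pose S' := [pred j | skew_vec P (col j X)].
rewrite -[RHS]scale1r in PT; rewrite -scaleN1r in PT'.
have [j /eqP->|leS chS] := @char_poly_restricted _ _ P M X d 1 T S TT PT Xu MX.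
  by rewrite scale1r.
have [j /eqP->|leS' chS'] :=
    @char_poly_restricted _ _ P M X d (-1) T' S' TT' PT' Xu MX.
  by rewrite scaleN1r.
(* Every index lies in [S] or [S'], so their cardinalities add up to at least [m], the sum of the
   two dimensions that bound them; both bounds are therefore attained. *)
have cardU : #|[predU S & S']| = m.
  by rewrite -[RHS]card_ord; apply: eq_card => j; rewrite !inE; apply: spl.
have cardSS' : (m <= #|S| + #|S'|)%N by rewrite -cardUI cardU leq_addr.
have dimE : (\rank (eigenspace P^T 1) + \rank (eigenspace P^T (-1)))%N = m.
  exact: sym_skew_dim.
have cardEq := geq_leqif (leqif_add (leqif_eq leS) (leqif_eq leS')).
move: cardSS'; rewrite -{1}dimE cardEq => /andP[/eqP cardS /eqP cardS'].
rewrite /eigenvalues_are /sym_eigenvalues /skew_eigenvalues !big_map !big_filter.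
by rewrite chS // chS' // !big_enum_cond.
Qed.

End Decomposition.

(** * The case of a Kronecker product *)

Theorem proposition1 (R : realType) (n : nat) (A B : 'M[R]_n)
    (P : 'M[R]_(n * n))
    (hAB : (A^T = A /\ B^T = B) \/ (A^T = - A /\ B^T = - B))
    (hPsym : P^T = P) (hPinv : P *m P = 1%:M) :
  let M := A *t B + P *m (A *t B) *m P in
  [/\ exists (X : 'M[R]_(n * n)) (d : 'rV[R]_(n * n)),
        [/\ eigendecomposition M X d, X^T *m X = 1%:M & splits_sym_skew P X],
      exists (Theta : 'M[R]_(n * n, sym_dim P))
             (Theta' : 'M[R]_(n * n, skew_dim P)),
        sym_basis Theta /\ skew_basis Theta'
    & forall (X : 'M[R]_(n * n)) (d : 'rV[R]_(n * n))
             (Theta : 'M[R]_(n * n, sym_dim P))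
             (Theta' : 'M[R]_(n * n, skew_dim P)),
        eigendecomposition M X d -> splits_sym_skew P X ->
        sym_basis Theta -> skew_basis Theta' ->
        eigenvalues_are (2%:R *: (Theta^T *m (A *t B) *m Theta))
                        (sym_eigenvalues P X d) /\
        eigenvalues_are (2%:R *: (Theta'^T *m (A *t B) *m Theta'))
                        (skew_eigenvalues P X d)].
Proof.
move=> M; pose K := A *t B; rewrite -/K in M *.
have Ksym : K^T = K.
  rewrite /K trmx_tens.
  (* In the skew-symmetric case the two signs cancel in each entry. *)
  by case: hAB => -[-> ->] //; apply/matrixP => i j; rewrite !mxE mulrNN.
have Msym : M^T = M.
  by rewrite /M linearD /= !trmx_mul Ksym hPsym mulmxA.
have PM : P *m M = M *m P.
  rewrite /M mulmxDr mulmxDl !mulmxA hPinv mul1mx -(mulmxA _ P P) hPinv mulmx1.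
  exact: addrC.
split.
- exact: split_eigendecomposition_exists.
- have [T [_ [TT PT _]]] := eigenspace_spectral_basis hPsym Msym PM 1.
  have [T' [_ [TT' PT' _]]] := eigenspace_spectral_basis hPsym Msym PM (-1).
  exists T, T'; split; split=> //; first by rewrite PT scale1r.
  by rewrite PT' scaleN1r.
move=> X d T T' eigM spl bT bT'.
have [] := restricted_eigenvalues hPinv eigM spl bT bT'.
have [[_ PT] [_ PT']] := (bT, bT').
(* The restrictions of [M] become twice those of [K], first for a = 1, then for a = -1. *)
rewrite (tr_basis_conj_eq K hPsym (mulr1 1)) ?scale1r //.
by rewrite (tr_basis_conj_eq K hPsym (etrans (mulrNN 1 1) (mulr1 1))) ?scaleN1r.
Qed.
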